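(* Let $R$ be a non-commutative ring with unity, let $n=3$ or $n=4$, and let $A\in M_n(R)$. Then $A$ is a (finite) sum of fifth powers of matrices in $M_n(R)$ if and only if $\operatorname{tr}(A)$ is the sum of a fifth power $c^5$ of an element $c \in R$ and finitely many cyclic sums $C(a_1,a_2,a_3,a_4,a_5)$ with $a_1,\dots,a_5\in R$.
   Context: $M_n(R)$ is the ring of $n\times n$ matrices over $R$, and $\operatorname{tr}$ denotes the sum of the diagonal entries. For $a_1,\dots,a_5\in R$ the cyclic sum (''five-cycle'') is $$C(a_1,a_2,a_3,a_4,a_5)=a_1a_2a_3a_4a_5+a_5a_1a_2a_3a_4+a_4a_5a_1a_2a_3+a_3a_4a_5a_1a_2+a_2a_3a_4a_5a_1 .$$ *)

(* Defs.v *)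
From HB Require Import structures.
From mathcomp Require Import all_boot all_order all_algebra.

Set Implicit Arguments.
Unset Strict Implicit.
Unset Printing Implicit Defensive.

Import GRing.Theory.
Local Open Scope ring_scope.

Definition five_cycle (R : pzRingType) (a1 a2 a3 a4 a5 : R) : R :=
  a1 * a2 * a3 * a4 * a5 + a5 * a1 * a2 * a3 * a4 + a4 * a5 * a1 * a2 * a3
  + a3 * a4 * a5 * a1 * a2 + a2 * a3 * a4 * a5 * a1.

Definition sum_of_fifth_powers (S : pzRingType) (x : S) : Prop :=
  exists (m : nat) (b : 'I_m -> S), x = \sum_(i < m) b i ^+ 5.

Definition fifth_power_plus_five_cycles (R : pzRingType) (t : R) : Prop :=
  exists (c : R) (m : nat) (a1 a2 a3 a4 a5 : 'I_m -> R),
    t = c ^+ 5 + \sum_(i < m) five_cycle (a1 i) (a2 i) (a3 i) (a4 i) (a5 i).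

(* Main.v *)
Require Import Defs.
From HB Require Import structures.
From mathcomp Require Import all_boot all_order all_algebra.

Set Implicit Arguments.
Unset Strict Implicit.
Unset Printing Implicit Defensive.

Import GRing.Theory.
Local Open Scope ring_scope.

(** Modulo sums of five-cycles, which form a subgroup closed under opposite,
    the fifth power is additive (the non-constant words of length 5 fall into
    free orbits under rotation) and [\tr (B ^+ 5)] is [\tr B ^+ 5]; this gives
    one direction.

    For the converse, polarization shows that the sum of all products of five
    given matrices, over all orderings, is a signed sum of fifth powers. Take
    the five matrices to be multiples of matrix units [E_uv], seen as edges
    [u -> v]: only Eulerian trails survive. The trail 0,0,1,1,2,2 yields every
    [a E_ij] with [i <> j], and the 3-cycle with loops at 0 and 1 has a single
    Eulerian circuit up to rotation, which yields a diagonal matrix whose trace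
    is an arbitrary five-cycle. Hence every matrix of trace 0 is a sum of fifth
    powers, and so is [x E_ii] for every five-cycle [x]. *)

(** * Finite sums of generators *)

(** A list of generators makes addition concatenation; [G] is arbitrary so as to cover both fifth
    powers and five-cycles. *)
Definition sum_of (V : zmodType) (J : Type) (G : J -> V) (x : V) : Prop :=
  exists s : seq J, x = \sum_(j <- s) G j.

Section SumOf.
Variables (V : zmodType) (J : Type) (G : J -> V).

Lemma sum_of1 j : sum_of G (G j).
Proof. by exists [:: j]; rewrite big_seq1. Qed.

Lemma sum_of0 : sum_of G 0.
Proof. by exists [::]; rewrite big_nil. Qed.

Lemma sum_ofD x y : sum_of G x -> sum_of G y -> sum_of G (x + y).
Proof. by move=> [s ->] [t ->]; exists (s ++ t); rewrite big_cat. Qed.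

Lemma sum_of_sum I (r : seq I) (P : pred I) (F : I -> V) :
  (forall i, P i -> sum_of G (F i)) -> sum_of G (\sum_(i <- r | P i) F i).
Proof. by move=> GF; apply: big_ind GF; [exact: sum_of0 | exact: sum_ofD]. Qed.

Lemma sum_ofN (h : J -> J) x :
  (forall j, G (h j) = - G j) -> sum_of G x -> sum_of G (- x).
Proof.
move=> Gh [s ->]; exists (map h s).
by rewrite big_map -sumrN; apply: eq_bigr => j _; rewrite Gh.
Qed.

End SumOf.

(** * Noncommutative expansion and polarization *)

Section Words.
Variable S : pzRingType.

Fixpoint words (L : Type) (s : seq L) k : seq (seq L) :=
  if k is k'.+1 then [seq x :: w | x <- s, w <- words s k'] else [:: [::]].

Lemma expr_sum_words (L : Type) (s : seq L) (X : L -> S) k :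
  (\sum_(x <- s) X x) ^+ k = \sum_(w <- words s k) \prod_(x <- w) X x.
Proof.
elim: k => [|k IHk] /=; first by rewrite big_seq1 big_nil.
rewrite exprS IHk big_allpairs_dep big_distrl /=; apply: eq_bigr => x _.
by rewrite big_distrr /=; apply: eq_bigr => w _; rewrite big_cons.
Qed.

(** Turns the words over a sub-alphabet into the expansion of a single power, that of the partial
    sum. *)
Lemma words_filter (L : Type) (s : seq L) (P : pred L) k :
  [seq w <- words s k | all P w] = words [seq x <- s | P x] k.
Proof.
elim: k => //= k <-; move: (words s k) => W; elim: s => //= x s IHs.
rewrite filter_cat filter_map IHs (eq_filter (a2 := fun w => P x && all P w)) //.
by case: (P x) => //; rewrite [filter _ W]filter_pred0.
Qed.

Lemma sum_of_oddXN (k : nat) (y : S) :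
  odd k -> sum_of (fun z : S => z ^+ k) y -> sum_of (fun z : S => z ^+ k) (- y).
Proof.
by move=> k_odd; apply: (sum_ofN (h := -%R)) => z; rewrite exprNn -signr_odd k_odd mulN1r.
Qed.

(* Inclusion-exclusion over the letters of [t], which are required to occur;
   [P] restricts the available letters and makes the induction go through. *)
Lemma sum_words_onto (L : eqType) (s t : seq L) (P : pred L) (X : L -> S) k :
  odd k ->
  sum_of (fun y : S => y ^+ k)
    (\sum_(w <- words s k | all P w && all (mem w) t) \prod_(x <- w) X x).
Proof.
move=> k_odd; elim: t P => [|x t IHt] P /=.
  under eq_bigl do rewrite andbT.
  by rewrite -big_filter words_filter -expr_sum_words; apply: sum_of1.
have := sum_ofD (IHt P) (sum_of_oddXN k_odd (IHt (predI P (predC1 x)))).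
rewrite (bigID (fun w : seq L => x \in w)) /= -addrA.
under [X in _ + (X + _)]eq_bigl => w.
  have -> : all P w && all (mem w) t && (x \notin w)
          = all (predI P (predC1 x)) w && all (mem w) t.
    rewrite all_predI -has_pred1 -all_predC andbAC; congr (_ && _ && _).
  over.
rewrite subrr addr0; congr sum_of; apply: eq_bigl => w.
by rewrite andbCA andbC andbA andbAC.
Qed.

End Words.

(** * Fifth powers modulo five-cycles *)

Section FiveCycles.
Variable R : pzRingType.

Definition five_cycle_of (a : R * R * R * R * R) : R :=
  let: (a1, a2, a3, a4, a5) := a in five_cycle a1 a2 a3 a4 a5.

Lemma sum_of_five_cycle a1 a2 a3 a4 a5 :
  sum_of five_cycle_of (five_cycle a1 a2 a3 a4 a5).
Proof. exact: (sum_of1 five_cycle_of (a1, a2, a3, a4, a5)). Qed.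

Lemma sum_of_five_cycleN x : sum_of five_cycle_of x -> sum_of five_cycle_of (- x).
Proof.
apply: (sum_ofN (h := fun a => let: (a1, a2, a3, a4, a5) := a in (- a1, a2, a3, a4, a5))).
by case=> [[[[a1 a2] a3] a4] a5]; rewrite /= /five_cycle !(mulNr, mulrN) !opprD.
Qed.

Lemma exprD5 (S : pzRingType) (x y : S) :
  (x + y) ^+ 5 = x ^+ 5 + y ^+ 5
  + (five_cycle x x x x y + five_cycle x x x y y + five_cycle x x y x y
     + five_cycle x x y y y + five_cycle x y x y y + five_cycle x y y y y).
Proof.
pose X (b : bool) := if b then x else y.
pose t := true; pose f := false.
have -> : x + y = \sum_(b <- [:: t; f]) X b by rewrite !big_cons big_nil addr0.
rewrite expr_sum_words.
(* The rotations are listed in the order of the terms of [five_cycle]; [W] is the two constant words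
   and the six free orbits. *)
pose cyc w := [seq rot k w | k <- [:: 0; 4; 3; 2; 1]%N] : seq (seq bool).
pose W := [:: nseq 5 t; nseq 5 f] ++ cyc [:: t; t; t; t; f] ++ cyc [:: t; t; t; f; f]
  ++ cyc [:: t; t; f; t; f] ++ cyc [:: t; t; f; f; f] ++ cyc [:: t; f; t; f; f]
  ++ cyc [:: t; f; f; f; f].
rewrite (perm_big W); last by vm_compute.
rewrite /W /cyc /rot /= !big_cons !big_nil /X /=.
by rewrite /five_cycle !exprS !expr0 !mulr1 !mulrA !addrA addr0.
Qed.

(** Stated for an additive [f] so as to serve both the identity of [R] and the matrix trace. *)
Lemma additive_sum_expr5 (S : pzRingType) (f : {additive S -> R})
    (fC : forall a1 a2 a3 a4 a5, sum_of five_cycle_of (f (five_cycle a1 a2 a3 a4 a5)))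
    (I : Type) (r : seq I) (X : I -> S) :
  sum_of five_cycle_of (f ((\sum_(i <- r) X i) ^+ 5) - \sum_(i <- r) f (X i ^+ 5)).
Proof.
elim: r => [|i r IHr]; first by rewrite !big_nil expr0n raddf0 subrr; apply: sum_of0.
rewrite !big_cons exprD5 raddfD [f (_ ^+ 5 + _)]raddfD opprD.
rewrite -[in X in X + _]addrA addrACA subrr add0r addrAC.
by apply: sum_ofD; rewrite // 5!raddfD; do !apply: sum_ofD.
Qed.

Lemma five_cycles_equiv_sum_expr5 (I : Type) (r : seq I) (x : I -> R) :
  sum_of five_cycle_of ((\sum_(i <- r) x i) ^+ 5 - \sum_(i <- r) x i ^+ 5).
Proof. exact: (additive_sum_expr5 (f := idfun) sum_of_five_cycle). Qed.

End FiveCycles.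

(** * Traces and products of matrix units *)

Section Matrices.
Variables (R : pzRingType) (n : nat).

Lemma mul_scale_delta_mx (a b : R) (i j k l : 'I_n) :
  (a *: delta_mx i j) * (b *: delta_mx k l) =
  if j == k then (a * b) *: delta_mx i l else 0 :> 'M[R]_n.
Proof.
apply/matrixP => r c; rewrite mxE (bigD1 j) //= big1 => [|m m_neq_j].
  rewrite addr0 (fun_if (fun M : 'M_n => M r c)) !mxE eqxx andbT.
  by case: (r == i) (j == k) (c == l) => [] [] []; rewrite /= ?(mulr0, mulr1, mul0r).
by rewrite !mxE (negbTE m_neq_j) andbF mulr0 mul0r.
Qed.

Lemma mxtrace_delta_mx (i j : 'I_n) : \tr (delta_mx i j : 'M[R]_n) = (i == j)%:R.
Proof.
rewrite /mxtrace (bigD1 i) //= big1 => [|k k_neq_i]; rewrite !mxE ?eqxx ?addr0 //.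
by rewrite (negbTE k_neq_i).
Qed.

Lemma exchange_sum5 (F : 'I_n -> 'I_n -> 'I_n -> 'I_n -> 'I_n -> R) :
  \sum_i \sum_j \sum_k \sum_l \sum_m F i j k l m =
  \sum_i \sum_j \sum_k \sum_l \sum_m F m i j k l.
Proof.
rewrite exchange_big; apply: eq_bigr => i _.
rewrite exchange_big; apply: eq_bigr => j _.
by rewrite exchange_big; apply: eq_bigr => k _; rewrite exchange_big.
Qed.

Lemma mxtrace_mul5 (A B C D E : 'M[R]_n) :
  \tr (A * B * C * D * E) =
  \sum_i \sum_j \sum_k \sum_l \sum_m A i j * B j k * C k l * D l m * E m i.
Proof.
rewrite -!mulrA; apply: eq_bigr => i _; rewrite mxE; apply: eq_bigr => j _.
rewrite mxE mulr_sumr; apply: eq_bigr => k _; rewrite mxE !mulr_sumr; apply: eq_bigr => l _.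
by rewrite mxE !mulr_sumr; apply: eq_bigr => m _; rewrite !mulrA.
Qed.

(** The trace is not cyclic over a noncommutative ring, but rotating the matrices and renaming the
    indices accordingly rotates the entries along the same closed path. *)
Lemma mxtrace_five_cycle (A B C D E : 'M[R]_n) :
  \tr (five_cycle A B C D E) = \sum_i \sum_j \sum_k \sum_l \sum_m
    five_cycle (A i j) (B j k) (C k l) (D l m) (E m i).
Proof.
rewrite /five_cycle !raddfD /= !mxtrace_mul5.
(* The p-th term needs p - 1 rotations of its indices. *)
rewrite [in X in _ + X + _ + _ + _]exchange_sum5.
do 2!rewrite [in X in _ + _ + X + _ + _]exchange_sum5.
do 3!rewrite [in X in _ + _ + _ + X + _]exchange_sum5.
do 4!rewrite [in X in _ + _ + _ + _ + X]exchange_sum5.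
rewrite -!big_split; apply: eq_bigr => i _ /=.
rewrite -!big_split; apply: eq_bigr => j _ /=.
rewrite -!big_split; apply: eq_bigr => k _ /=.
rewrite -!big_split; apply: eq_bigr => l _ /=.
by rewrite -!big_split; apply: eq_bigr.
Qed.

(** Split [B] into its entries times matrix units: only the diagonal ones have fifth powers of
    nonzero trace, and the sum of the [B i i ^+ 5] is congruent to [\tr B ^+ 5]. *)
Lemma mxtrace_expr5 (B : 'M[R]_n) :
  sum_of (@five_cycle_of R) (\tr (B ^+ 5) - \tr B ^+ 5).
Proof.
have trC (A1 A2 A3 A4 A5 : 'M[R]_n) : sum_of (@five_cycle_of R) (\tr (five_cycle A1 A2 A3 A4 A5)).
  by rewrite mxtrace_five_cycle; do 5![apply: sum_of_sum => ? _]; apply: sum_of_five_cycle.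
pose E (i j : 'I_n) : 'M[R]_n := B i j *: delta_mx i j.
have trE5 i j : \tr (E i j ^+ 5) = if j == i then B i i ^+ 5 else 0.
  rewrite !exprS expr0 mulr1; have [->|ji] := eqVneq j i.
    by rewrite !(mul_scale_delta_mx, eqxx) mxtraceZ mxtrace_delta_mx eqxx expr0 !mulr1 !mulrA.
  by rewrite /E !mul_scale_delta_mx (negbTE ji) !mulr0 mxtrace0.
have BE : B = \sum_(p : 'I_n * 'I_n) E p.1 p.2.
  by rewrite [LHS]matrix_sum_delta pair_bigA.
have := additive_sum_expr5 (f := @mxtrace R n) trC (index_enum _) (fun p => E p.1 p.2).
rewrite -BE -(pair_bigA _ (fun i j => \tr (E i j ^+ 5))) /=.
under eq_bigr do under eq_bigr do rewrite trE5.
under eq_bigr do rewrite -big_mkcond big_pred1_eq.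
move=> Ctr; have := sum_ofD Ctr (sum_of_five_cycleN
  (five_cycles_equiv_sum_expr5 (index_enum _) (fun i => B i i))).
by rewrite opprB addrA subrK.
Qed.

Lemma prod_nonpath_eq0 (V : eqType) (phi : V -> 'I_n) (a : V * V -> R) w :
  injective phi -> ~~ sorted (fun e e' : V * V => e.2 == e'.1) w ->
  \prod_(e <- w) (a e *: delta_mx (phi e.1) (phi e.2)) = 0 :> 'M[R]_n.
Proof.
move=> phi_inj; case: w => //= e w; elim: w e => //= e' w IHw e.
rewrite negb_and big_cons => /orP[neq | /IHw ->]; last by rewrite mulr0.
by rewrite big_cons mulrA mul_scale_delta_mx (inj_eq phi_inj) (negbTE neq) mul0r.
Qed.

(** For five distinct edges the remaining words are the Eulerian trails. Vertices live in [V], apart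
    from ['I_n], so that trails can be enumerated by computation for every [n]. *)
Lemma sum_trails (V : eqType) (phi : V -> 'I_n) (a : V * V -> R) (es : seq (V * V)) :
  injective phi ->
  sum_of (fun B : 'M[R]_n => B ^+ 5)
    (\sum_(w <- [seq w <- words es 5 |
                 sorted (fun e e' => e.2 == e'.1) w && all (mem w) es])
       \prod_(e <- w) (a e *: delta_mx (phi e.1) (phi e.2))).
Proof.
move=> phi_inj.
have := sum_words_onto es es predT
  (fun e => a e *: delta_mx (phi e.1) (phi e.2) : 'M[R]_n) (k := 5) isT.
rewrite (bigID (sorted (fun e e' => e.2 == e'.1))) /= addrC big1 ?add0r;
  last by move=> w /andP[_ /prod_nonpath_eq0->].
by rewrite big_filter; congr sum_of; apply: eq_bigl => w; rewrite all_predT andbC.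
Qed.

(** * Two graphs on three vertices *)

Section Corner.
Variable phi : 'I_3 -> 'I_n.
Hypothesis phi_inj : injective phi.
Let v0 : 'I_3 := @Ordinal 3 0 isT.
Let v1 : 'I_3 := @Ordinal 3 1 isT.
Let v2 : 'I_3 := @Ordinal 3 2 isT.

Lemma sum_of_delta_mx (a : R) :
  sum_of (fun B : 'M[R]_n => B ^+ 5) (a *: delta_mx (phi v0) (phi v2)).
Proof.
pose es := [:: (v0, v0); (v0, v1); (v1, v1); (v1, v2); (v2, v2)].
pose c e := if e == (v0, v0) then a else 1.
have := sum_trails c es phi_inj.
have -> : [seq w <- words es 5 | sorted (fun e e' => e.2 == e'.1) w && all (mem w) es]
  = [:: es] by vm_compute.
rewrite big_seq1 !big_cons big_nil mulr1 /=.
by rewrite !(mul_scale_delta_mx, eqxx) /c /= !mulr1.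
Qed.

Lemma sum_of_five_cycle_diag (a1 a2 a3 a4 a5 : R) :
  sum_of (fun B : 'M[R]_n => B ^+ 5)
    ((a1 * a2 * a3 * a4 * a5 + a2 * a3 * a4 * a5 * a1) *: delta_mx (phi v0) (phi v0)
     + (a3 * a4 * a5 * a1 * a2 + a4 * a5 * a1 * a2 * a3) *: delta_mx (phi v1) (phi v1)
     + (a5 * a1 * a2 * a3 * a4) *: delta_mx (phi v2) (phi v2)).
Proof.
pose es := [:: (v0, v0); (v0, v1); (v1, v1); (v1, v2); (v2, v0)].
(* The k-th edge of the circuit carries the k-th coefficient, so each rotation of the circuit gives
   one term of the five-cycle, placed at its starting vertex. *)
pose c e := nth 0 [:: a1; a2; a3; a4; a5] (index e es).
have := sum_trails c es phi_inj.
have -> : [seq w <- words es 5 | sorted (fun e e' => e.2 == e'.1) w && all (mem w) es]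
  = [seq rot k es | k <- [:: 0; 1; 2; 3; 4]%N] by vm_compute.
rewrite /rot /= !big_cons !big_nil !mulr1.
by rewrite !(mul_scale_delta_mx, eqxx) /c /= !mulrA !scalerDl addr0 !addrA.
Qed.

End Corner.

(** * Reduction to the trace *)

Hypothesis n_gt2 : (2 < n)%N.

Lemma exists_third (i j : 'I_n) : exists k, (k != i) && (k != j).
Proof.
have : (0 < #|~: [set i; j]|)%N.
  rewrite cardsCs setCK card_ord subn_gt0 cards2.
  by case: (_ != _) => //; apply: ltn_trans n_gt2.
by case/card_gt0P=> k; rewrite !inE negb_or => ?; exists k.
Qed.

Let corner (i j k : 'I_n) (v : 'I_3) := nth i [:: i; j; k] v.

Lemma corner_inj (i j k : 'I_n) : i != j -> i != k -> j != k -> injective (corner i j k).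
Proof.
move=> ij ik jk v w /eqP; rewrite nth_uniq ?ltn_ord // => [/eqP/val_inj //|].
by rewrite /= !inE negb_or ij ik jk.
Qed.

Lemma sum_of_offdiag (i j : 'I_n) (a : R) :
  i != j -> sum_of (fun B : 'M[R]_n => B ^+ 5) (a *: delta_mx i j).
Proof.
move=> ij; have [k /andP[ki kj]] := exists_third i j.
(* The trail runs from [i] to [j], with [k] as middle vertex. *)
have ikj : injective (corner i k j) by apply: corner_inj; rewrite // eq_sym.
exact: sum_of_delta_mx ikj a.
Qed.

(* With all coefficients but the first equal to 1, the circuit matrix is
   [2a, 2a, a] on the diagonal; the vertex without loop can be [i] or [j]. *)
Lemma sum_of_diag_sub (i j : 'I_n) (a : R) :
  sum_of (fun B : 'M[R]_n => B ^+ 5) (a *: delta_mx i i - a *: delta_mx j j).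
Proof.
have [<-|ij] := eqVneq i j; first by rewrite subrr; apply: sum_of0.
have [k /andP[ki kj]] := exists_third i j.
have ijk : injective (corner i k j) by apply: corner_inj; rewrite // eq_sym.
have jik : injective (corner j k i) by apply: corner_inj; rewrite // eq_sym.
have := sum_ofD (sum_of_five_cycle_diag ijk a 1 1 1 1)
  (sum_of_oddXN (k := 5) isT (sum_of_five_cycle_diag jik a 1 1 1 1)).
rewrite /corner /= !(mulr1, mul1r) !scalerDl.
set x := a *: delta_mx i i; set y := a *: delta_mx j j; set z := a *: delta_mx k k.
move: (z + z) => u; have -> : x + x + u + y = x + (y + u + x).
  by rewrite -2!addrA; congr (x + _); rewrite addrC [u + y]addrC.
have -> : y + y + u + x = y + (y + u + x) by rewrite -!addrA.
by rewrite opprD addrACA subrr addr0.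
Qed.

(** Row [j] contributes its diagonal entry times [E_jj - E_ii], plus off-diagonal terms. *)
Lemma sum_of_sub_trace (A : 'M[R]_n) (i : 'I_n) :
  sum_of (fun B : 'M[R]_n => B ^+ 5) (A - \tr A *: delta_mx i i).
Proof.
rewrite {1}[A]matrix_sum_delta /mxtrace scaler_suml -sumrB.
apply: sum_of_sum => j _; rewrite (bigD1 j) //= addrAC.
apply: sum_ofD; first exact: sum_of_diag_sub.
by apply: sum_of_sum => k; rewrite eq_sym; apply: sum_of_offdiag.
Qed.

(** Subtracting [D - \tr D *: E_ii] from the circuit matrix [D] gathers its whole trace at position
    [i]. *)
Lemma sum_of_five_cycle_mx (i : 'I_n) (x : R) :
  sum_of (@five_cycle_of R) x ->
  sum_of (fun B : 'M[R]_n => B ^+ 5) (x *: delta_mx i i).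
Proof.
case=> s ->; rewrite scaler_suml; apply: sum_of_sum => [[[[[a1 a2] a3] a4] a5]] _ /=.
have [j /andP[ji _]] := exists_third i i; have [k /andP[ki kj]] := exists_third i j.
have ijk : injective (corner i j k) by apply: corner_inj; rewrite // eq_sym.
have := sum_of_five_cycle_diag ijk a1 a2 a3 a4 a5; set D := (X in sum_of _ X).
have trD : \tr D = five_cycle a1 a2 a3 a4 a5.
  rewrite /D !mxtraceD !mxtraceZ !mxtrace_delta_mx !eqxx !mulr1.
  by rewrite [LHS](AC (2*2*1) (1*5*4*3*2)).
move=> CD; have := sum_ofD CD (sum_of_oddXN (k := 5) isT (sum_of_sub_trace D i)).
by rewrite opprB addrC subrK trD.
Qed.

Lemma sum_of_fifth_powers_iff (A : 'M[R]_n) :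
  sum_of (fun B : 'M[R]_n => B ^+ 5) A <->
  exists c, sum_of (@five_cycle_of R) (\tr A - c ^+ 5).
Proof.
split=> [[s ->] | [c Cc]].
  (* Modulo five-cycles the fifth powers of the traces merge into the single fifth power of their
     sum. *)
  exists (\sum_(B <- s) \tr B).
  rewrite raddf_sum.
  have := sum_ofD (sum_of_sum s (P := xpredT) (fun B _ => mxtrace_expr5 B))
    (sum_of_five_cycleN (five_cycles_equiv_sum_expr5 s (fun B => \tr B))).
  by rewrite sumrB opprB addrA subrK.
have i : 'I_n by apply: Ordinal n_gt2.
(* [A] is the sum of [A - \tr A *: E_ii], [(\tr A - c ^+ 5) *: E_ii] and [(c *: E_ii) ^+ 5]. *)
have := sum_ofD (sum_of_sub_trace A i) (sum_of_five_cycle_mx i Cc).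
rewrite scalerBl addrA subrK => CA.
have := sum_ofD CA (sum_of1 (fun B : 'M[R]_n => B ^+ 5) (c *: delta_mx i i)).
by rewrite [in _ ^+ 5]exprS !exprS expr0 !mulr1 !(mul_scale_delta_mx, eqxx) subrK.
Qed.

End Matrices.

(** * From lists to indexed families *)

Lemma sum_of_fifth_powersE (S : pzRingType) (x : S) :
  sum_of_fifth_powers x <-> sum_of (fun y => y ^+ 5) x.
Proof.
split=> [[m [b ->]] | [s ->]]; first by apply: sum_of_sum => i _; apply: sum_of1.
by exists (size s), (tnth (in_tuple s)); rewrite big_tnth.
Qed.

Lemma fifth_power_plus_five_cyclesE (R : pzRingType) (t : R) :
  fifth_power_plus_five_cycles t <-> exists c, sum_of (@five_cycle_of R) (t - c ^+ 5).
Proof.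
split=> [[c [m [a1 [a2 [a3 [a4 [a5 ->]]]]]]] | [c [s ts]]].
  by exists c; rewrite addrC addKr; apply: sum_of_sum => i _; apply: sum_of_five_cycle.
pose a i := tnth (in_tuple s) i.
exists c, (size s), (fun i => (a i).1.1.1.1), (fun i => (a i).1.1.1.2),
  (fun i => (a i).1.1.2), (fun i => (a i).1.2), (fun i => (a i).2).
rewrite -[LHS](subrK (c ^+ 5)) addrC ts big_tnth; congr (_ + _).
by apply: eq_bigr => i _; rewrite /a; case: (tnth _ _) => [[[[? ?] ?] ?] ?].
Qed.

Theorem theorem7 (R : pzRingType) (n : nat) (hn : n = 3%N \/ n = 4%N)
    (A : 'M[R]_n) :
  sum_of_fifth_powers A <-> fifth_power_plus_five_cycles (\tr A).
Proof.
have n_gt2 : (2 < n)%N by case: hn => ->.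
apply: iff_trans (sum_of_fifth_powersE _) _.
apply: iff_trans (sum_of_fifth_powers_iff n_gt2 _) _.
exact: iff_sym (fifth_power_plus_five_cyclesE _).
Qed.
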